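(* Let $\mathcal{L}(\mathbb{R})=\big\{\sum_{j=1}^n a_j\delta_{x_j}:x_j\in\mathbb{R},\ a_j>0,\ \sum_{j=1}^n a_j=1,\ n\in\mathbb{N}\big\}$ and let $\vartheta$ be a probability measure on $\mathbb{R}$ with finite support. Then, for a fixed $\omega\in\mathcal{L}(\mathbb{R})$, $$\dim_L(\vartheta*\omega)=\dim_L(\vartheta),$$ where $\vartheta*\omega$ is the convolution of $\vartheta$ and $\omega$.
   Context: $\delta_x$ is the Dirac measure at $x$. The convolution $\vartheta*\omega$ is the push-forward of the product measure $\vartheta\times\omega$ under $(x,y)\mapsto x+y$. For a Borel probability measure $\vartheta$ on $\mathbb{R}$ with support $\mathrm{supp}(\vartheta)$ of diameter $|\mathrm{supp}(\vartheta)|>0$, the lower dimension is $$\dim_L(\vartheta)=\sup\Big\{\beta\ge0:\exists M>0\text{ such that }\forall\,0<r<R\le|\mathrm{supp}(\vartheta)|\text{ and }x\in\mathrm{supp}(\vartheta),\ \frac{\vartheta(\mathcal{B}_R(x))}{\vartheta(\mathcal{B}_r(x))}\ge M\Big(\frac{R}{r}\Big)^\beta\Big\},$$ where $\mathcal{B}_R(x)=\{y\in\mathbb{R}:|y-x|\le R\}$; if $|\mathrm{supp}(\vartheta)|=0$, then $\dim_L(\vartheta)=0$. *)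

(* Defs.v *)
From HB Require Import structures.
From mathcomp Require Import all_boot all_order all_algebra.
From mathcomp Require Import all_classical all_reals all_analysis.

Set Implicit Arguments.
Unset Strict Implicit.
Unset Printing Implicit Defensive.

Import Order.TTheory GRing.Theory Num.Theory.
Import numFieldNormedType.Exports.

Local Open Scope classical_set_scope.
Local Open Scope ring_scope.

(* Borel probability measures on the real line: [measurableTypeR R] is [R] with
   the sigma-algebra generated by the half-open intervals. *)
Notation borel_prob R := (probability (measurableTypeR R) R).

Section lower_dimension.
Context {R : realType}.
Implicit Types (mu nu : borel_prob R) (x r : R).

Definition supp mu : set R :=
  [set x | forall U : set R, open U -> U x -> (0 < mu U)%E].

Definition diameter (A : set R) : \bar R :=
  ereal_sup [set `|p.1 - p.2|%:E | p in A `*` A].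

Definition Ball r x : set R := [set y | `|y - x| <= r].

(* The measures take values in [\bar R]; [fine] loses nothing since they are
   finite, and the denominator is positive because [x] lies in the support and
   [0 < r]. *)
Definition lower_dim_exponent mu (beta : R) : Prop :=
  exists2 M : R, 0 < M &
    forall r R' x : R, 0 < r -> r < R' -> (R'%:E <= diameter (supp mu))%E ->
      supp mu x ->
      fine (mu (Ball R' x)) / fine (mu (Ball r x)) >= M * (R' / r) `^ beta.

Definition dimL mu : \bar R :=
  if diameter (supp mu) == 0%E then 0%E
  else ereal_sup [set beta%:E | beta in
                   [set beta : R | 0 <= beta /\ lower_dim_exponent mu beta]].

Definition addR (p : measurableTypeR R * measurableTypeR R) :
  measurableTypeR R := (p.1 : R) + (p.2 : R).

Lemma measurable_addR : measurable_fun setT addR.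
Proof. exact: (measurable_realfun.measurable_funD measurable_fst measurable_snd). Qed.

HB.instance Definition _ :=
  isMeasurableFun.Build _ _ _ _ addR measurable_addR.

(* [distribution P X] is the push-forward of [P] under [X]. *)
Definition convolution mu nu : borel_prob R :=
  distribution (mu \x nu)%E addR.

Definition finite_dirac_mixtures : set (borel_prob R) :=
  [set omega | exists (n : nat) (x a : 'I_n -> R),
    [/\ forall j, 0 < a j, \sum_(j < n) a j = 1 &
        forall A : set (measurableTypeR R), measurable A ->
          omega A = (\sum_(j < n) (a j)%:E * \d_(x j) A)%E]].

End lower_dimension.

(* Main.v *)
(** A probability measure whose support is finite has lower dimension [0]: the
    points of its support are atoms, so the ratio of the masses of two balls
    stays bounded as the inner radius shrinks.  The support of
    [theta * omega] is contained in the sumset of the support of [theta] and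
    the atoms of [omega], hence is finite too, so both sides vanish. *)
Require Import Defs.
From mathcomp Require Import all_boot all_order all_algebra.
From mathcomp Require Import all_classical all_reals all_analysis.
From mathcomp Require Import measurable_realfun.
Import Order.TTheory GRing.Theory Num.Theory.
Import numFieldNormedType.Exports.

Local Open Scope classical_set_scope.

Section support.
Local Open Scope ring_scope.
Context {R : realType}.
Implicit Types mu nu : borel_prob R.

(** Open intervals with rational endpoints form a countable base of the line: each point outside the
    support lies in a null one, so countably many null intervals cover the complement. *)
Lemma negligible_setC_supp mu : mu.-negligible (~` supp mu).
Proof.
pose I (p : rat * rat) : set R := `]ratr p.1, ratr p.2[%classic.
(* Enumerates the null rational intervals along codes of pairs of rationals; all other codes give
   [set0]. *)
pose F n : set (measurableTypeR R) :=
  if (unpickle n : option (rat * rat)) is Some p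
  then (if mu (I p) == 0%E then I p else set0) else set0.
apply: (negligibleS (A := \bigcup_n F n)); last first.
  apply: negligible_bigcup => n; rewrite /F.
  case: (unpickle n) => [p|]; last exact: negligible_set0.
  case: ifPn => [/eqP Ip0|_]; last exact: negligible_set0.
  apply/negligibleP => //; exact: measurable_itv.
move=> x /= /existsNP[U] /not_implyP[oU] /not_implyP[Ux /negP].
rewrite -leNgt measure_le0 => /eqP U0.
have : nbhs x U by exact: open_nbhs_nbhs.
move=> /nbhs_ballP[e /= e0 eU].
have /rat_in_itvoo[p] : x - e < x by rewrite ltrBlDr ltrDl.
have /rat_in_itvoo[q] : x < x + e by rewrite ltrDl.
rewrite !in_itv/= => /andP[xq qe] /andP[ep px].
have IU : I (p, q) `<=` U.
  move=> y; rewrite /I/= in_itv/= => /andP[py yq]; apply: eU => /=.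
  rewrite /ball/= ltr_distlC; apply/andP; split.
    exact: lt_trans py.
  exact: lt_trans qe.
exists (pickle (p, q)); first exact: Logic.I.
rewrite /F pickleK.
have -> : mu (I (p, q)) = 0%E.
  apply/eqP; rewrite -measure_le0 -U0; apply: le_measure => //; rewrite inE.
    exact: measurable_itv.
  exact: open_measurable.
by rewrite eqxx /I /= in_itv/= px.
Qed.

Lemma supp_nonempty mu : supp mu !=set0.
Proof.
apply/set0P/eqP => supp0; have := negligible_setC_supp mu.
rewrite supp0 setC0 => /(measure_negligible measurableT) mu0.
by have := @probability_setT _ _ _ mu; rewrite mu0 => /esym/eqP; rewrite onee_eq0.
Qed.

Lemma finite_set_closedR (A : set R) : finite_set A -> closed A.
Proof.
by move: A; apply/accessible_finite_set_closed/hausdorff_accessible/Rhausdorff.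
Qed.

Lemma finite_set_measurableR (A : set (measurableTypeR R)) :
  finite_set A -> measurable A.
Proof. by move=> /finite_set_closedR; exact: closed_measurable. Qed.

Lemma sub_supp mu (F : set R) : closed F -> mu (~` F) = 0%E -> supp mu `<=` F.
Proof.
move=> cF F0 x; apply: contraPP => Fx /(_ (~` F) (closed_openC cF) Fx).
by rewrite F0 ltxx.
Qed.

(** Deleting [x] from a finite support leaves a closed set. Its complement is an open neighbourhood
    of [x], hence of positive mass, and it adds to [x] only the null complement of the support. *)
Lemma finite_supp_atom mu x : finite_set (supp mu) -> supp mu x ->
  (0 < mu [set x])%E.
Proof.
move=> fin xS; have cl : closed (supp mu `\ x).
  by apply: finite_set_closedR; exact: finite_setD.
have := xS _ (closed_openC cl); move=> /(_ (fun h => h.2 erefl)) U0.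
apply: (lt_le_trans U0).
have m1 : measurable ([set x] : set (measurableTypeR R)) by exact: measurable_set1.
have mS : measurable (~` supp mu : set (measurableTypeR R)).
  by apply: measurableC; exact: finite_set_measurableR.
have <- : mu ([set x] `|` ~` supp mu) = mu [set x].
  apply/eqP; rewrite eq_le; apply/andP; split; last first.
    by apply: le_measure; rewrite ?inE//; exact: measurableU.
  apply: (le_trans (measureU2 _ _ _)) => //.
  have /negligibleP -> // := negligible_setC_supp mu.
  by rewrite adde0.
apply: le_measure; rewrite ?inE.
- by apply: open_measurable; exact: closed_openC.
- exact: measurableU.
- move=> y /= yS; have [->|yx] := eqVneq y x; [by left|right=> Sy].
  by apply: yS; split => //; exact/eqP.
Qed.

Lemma Ball_itv (r x : R) : Ball r x = `[x - r, x + r]%classic.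
Proof.
by apply/seteqP; split => y; rewrite /Ball/= in_itv/= ler_distl.
Qed.

Lemma measurable_Ball (r x : R) :
  measurable (Ball r x : set (measurableTypeR R)).
Proof. by rewrite Ball_itv; exact: measurable_itv. Qed.

(** Balls grow with the radius, so the ratio is at least 1. This keeps the set of exponents
    nonempty, so that its supremum is not [-oo]. *)
Lemma lower_dim_exponent0 mu : lower_dim_exponent mu 0.
Proof.
exists 1 => // r R' x r0 rR _ xS; rewrite powRr0 mulr1.
have B0 : (0 < mu (Ball r x))%E.
  have := xS _ (ball_open x r) (ballxx x r0); move=> /lt_le_trans; apply.
  apply: le_measure; rewrite ?inE.
  - by apply: open_measurable; exact: ball_open.
  - exact: measurable_Ball.
  - by move=> y; rewrite /ball /Ball/= distrC => /ltW.
rewrite lter_pdivlMr ?mul1r.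
  apply: fine_le; rewrite ?fin_num_measure//; try exact: measurable_Ball.
  apply: le_measure; rewrite ?inE; try exact: measurable_Ball.
  by move=> y /= /le_trans; apply; exact: ltW.
apply: fine_gt0; rewrite B0 ltey_eq fin_num_measure//; exact: measurable_Ball.
Qed.

(* If [M (R' / r) ^ beta] bounded the ratio from below with [beta > 0], then it
   would be at most [1 / mu [set x]] for all [0 < r < R']; take [r] with
   [(R' / r) ^ beta = 1 + 1 / (M mu [set x])]. *)
Lemma finite_supp_exponent_eq0 mu (beta : R) : finite_set (supp mu) ->
  (0 < diameter (supp mu))%E -> 0 <= beta -> lower_dim_exponent mu beta ->
  beta = 0.
Proof.
move=> fin /ereal_sup_gt[_ [[x y] /= [xS yS] <-]]; rewrite lte_fin => D0.
rewrite le0r => /predU1P[//|beta0] [M M0 H].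
have cfin : mu [set x] \is a fin_num by rewrite fin_num_measure.
pose c := fine (mu [set x]).
have c0 : 0 < c.
  by apply: fine_gt0; rewrite finite_supp_atom//= ltey_eq cfin.
pose K := 1 + (M * c)^-1.
have K1 : 1 < K by rewrite ltrDl invr_gt0 mulr_gt0.
have K0 : 0 < K by exact: lt_trans K1.
(* [t] is the ratio of the radii [D] and [D / t], chosen so that its power [beta] is [K]. *)
pose t := K `^ beta^-1.
have t1 : 1 < t.
  have -> : 1 = 1 `^ beta^-1 by rewrite powR1.
  rewrite gt0_ltr_powR ?invr_gt0 ?nnegrE//.
  exact: ltW.
have t0 : 0 < t by exact: lt_trans t1.
set D := `|x - y| in D0 H.
have r0 : 0 < D / t by rewrite divr_gt0.
have := H (D / t) D x r0; rewrite ltr_pdivrMr// ltr_pMr// t1.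
move=> /(_ isT) /(_ _ xS) ratio.
have {ratio} : M * K <= 1 / c.
  have -> : K = (D / (D / t)) `^ beta.
    rewrite invf_div mulrCA divff ?gt_eqF// mulr1 /t -powRrM mulVf ?gt_eqF//.
    by rewrite powRr1//; exact: ltW.
  apply: le_trans (ratio _) _.
    apply: ereal_sup_ubound; exists (x, y) => //=.
  have mB s : measurable (Ball s x : set (measurableTypeR R)).
    exact: measurable_Ball.
  (* The inner ball contains the atom [x], which bounds the denominator below by [c]; the numerator
     is at most 1. *)
  have cB : c <= fine (mu (Ball (D / t) x)).
    apply: fine_le; rewrite ?fin_num_measure//; apply: le_measure; rewrite ?inE//.
    by move=> _ ->; rewrite /Ball/= subrr normr0 ltW.
  rewrite ler_pM ?invr_ge0 ?fine_ge0//.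
    by rewrite -lee_fin fineK ?fin_num_measure// probability_le1.
  by rewrite lef_pV2 ?posrE// (lt_le_trans c0).
(* Since [M * K] equals [M + 1 / c], the bound forces [M <= 0]. *)
rewrite /K mulrDr mulr1 invfM mulrA divff ?gt_eqF// mul1r.
by rewrite gerDr leNgt M0.
Qed.

Lemma dimL_finite_supp mu : finite_set (supp mu) -> dimL mu = 0%E.
Proof.
move=> fin; rewrite /dimL; case: ifPn => // D0.
(* A point of the support is required here: the supremum over an empty set would be [-oo], not a
   nonnegative value. *)
have D_gt0 : (0 < diameter (supp mu))%E.
  rewrite lt_neqAle eq_sym D0/=; have [x xS] := supp_nonempty mu.
  by apply: ereal_sup_ubound; exists (x, x) => //=; rewrite subrr normr0.
rewrite (_ : [set _ | _ in _] = [set 0%E]) ?ereal_sup1//.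
apply/seteqP; split => [_ [b /= [b0 Hb] <-]|_ ->] /=.
  by rewrite (finite_supp_exponent_eq0 _ _ fin D_gt0 b0 Hb).
by exists 0 => //; split => //; exact: lower_dim_exponent0.
Qed.

(** The sumset of [supp mu] and [G] is finite, hence closed, and it carries all the mass of the
    convolution; so it contains the support. *)
Lemma finite_supp_convolution mu nu (G : set R) :
  finite_set (supp mu) -> finite_set G -> nu (~` G) = 0%E ->
  finite_set (supp (convolution mu nu)).
Proof.
move=> finS finG G0; pose S := supp mu.
pose F := [set x + y | x in S & y in G].
have finF : finite_set F by exact: finite_image2.
apply: (sub_finite_set _ finF); apply: sub_supp; first exact: finite_set_closedR.
have mF : measurable (~` F : set (measurableTypeR R)).
  by apply: measurableC; exact: finite_set_measurableR.
have mS : measurable (~` S : set (measurableTypeR R)).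
  by apply: measurableC; exact: finite_set_measurableR.
have mG : measurable (~` G : set (measurableTypeR R)).
  by apply: measurableC; exact: finite_set_measurableR.
have S0 : mu (~` S) = 0%E.
  by apply: measure_negligible => //; exact: negligible_setC_supp.
change ((mu \x nu)%E (addR @^-1` (~` F)) = 0%E).
(* If [x + y] is outside the sumset, then [x] is outside [S] or [y] is outside [G]; both strips are
   null for the product. *)
have : (mu \x nu)%E.-negligible
    ((~` S) `*` [set: measurableTypeR R] `|` [set: measurableTypeR R] `*` (~` G)).
  apply: negligibleU; apply/negligibleP; try exact: measurableX.
    by apply: (etrans (product_measure1E mu nu mS measurableT)); rewrite [X in (X * _)%E]S0 mul0e.
  by apply: (etrans (product_measure1E mu nu measurableT mG)); rewrite [X in (_ * X)%E]G0 mule0.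
move=> N; apply/negligibleP.
  by rewrite -[X in measurable X]setTI; exact: measurable_addR.
apply: negligibleS N => -[x y] /= nF.
have [Sx|nSx] := pselect (S x); [right|by left].
by split=> // Gy; apply: nF; exists x => //; exists y.
Qed.

End support.

Theorem lemma3p6 (R : realType) (theta : borel_prob R)
    (theta_fin : finite_set (supp theta))
    (omega : borel_prob R) (omegaL : finite_dirac_mixtures omega) :
  dimL (convolution theta omega) = dimL theta.
Proof.
have [n [x [a [_ _ omegaE]]]] := omegaL.
have finG : finite_set (range x) by exact: finite_image.
rewrite !dimL_finite_supp//.
apply: (finite_supp_convolution _ _ _ theta_fin finG).
rewrite omegaE; last first.
  by apply: measurableC; exact: finite_set_measurableR.
(* Every atom [x j] lies in [range x], so each Dirac mass vanishes on the complement. *)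
rewrite big1// => j _; rewrite diracE memNset ?mule0//=; apply.
by exists j.
Qed.
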